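(* For all $n\geq1$, $$B_{n-1}^{neobc}B_{n+1}^{neobc}-(B_{n}^{neobc})^{2}=\frac{3B_{n+1}^{neobc}-6B_{n}^{neobc}+3B_{n-1}^{neobc}-648}{4},$$ $$C_{n-1}^{neobc}C_{n+1}^{neobc}-(C_{n}^{neobc})^{2}=1296,$$ $$R_{n-1}^{neobc}R_{n+1}^{neobc}-(R_{n}^{neobc})^{2}=\frac{-5R_{n+1}^{neobc}+10R_{n}^{neobc}-5R_{n-1}^{neobc}+648}{4},$$ and for all $n\geq2$, $$CR_{n-1}^{neobc}CR_{n+1}^{neobc}-(CR_{n}^{neobc})^{2}=-324.$$
   Context: A positive integer $m$ is a neo balcobalancing number if there is a positive integer $r$ (its neo balcobalancer) such that $(1+2+\cdots+(m-1))+(1+2+\cdots+m)=2[(m-1)+m+(m+1)+(m+2)+\cdots+(m+r)]$; then $r=\frac{-2m-1+\sqrt{8m^2-12m+9}}{2}$ (equivalently, $m$ is a neo balcobalancing number iff $8m^2-12m+9$ is a perfect square). For $n\ge1$, $B_n^{neobc}$ denotes the $n$-th neo balcobalancing number in increasing order, $R_n^{neobc}$ its neo balcobalancer, $C_n^{neobc}=\sqrt{8(B_n^{neobc})^2-12B_n^{neobc}+9}$ and $CR_n^{neobc}=\sqrt{2(R_n^{neobc})^2+5R_n^{neobc}+2}$. By convention, $B_0^{neobc}=0$, $R_0^{neobc}=1$, $C_0^{neobc}=CR_0^{neobc}=3$. *)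

(* Defs.v *)
From mathcomp Require Import all_boot all_order all_algebra.
From mathcomp Require Import boolp reals.
From mathcomp Require Import zify.

Set Implicit Arguments.
Unset Strict Implicit.
Unset Printing Implicit Defensive.

Import Order.TTheory GRing.Theory Num.Theory.

Definition is_neobalcobalancer (m r : nat) : bool :=
  [&& 0 < m, 0 < r &
      \sum_(1 <= i < m) i + \sum_(1 <= i < m.+1) i
        == 2 * \sum_(m.-1 <= i < (m + r).+1) i].

Definition is_neobc (m : nat) : Prop := exists r, is_neobalcobalancer m r.

Lemma sum1n n : (\sum_(1 <= i < n.+1) i) * 2 = n * n.+1.
Proof.
elim: n => [|n IHn]; first by rewrite big_geq.
by rewrite big_nat_recr //= mulnDl IHn; lia.
Qed.

Lemma is_neobalcobalancerE m r : is_neobalcobalancer m r =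
  [&& 0 < m, 0 < r & m * m == (r + 2) * (2 * m + r - 1)].
Proof.
rewrite /is_neobalcobalancer; case: m => [|m] //; case: r => [|r] //=.
have step k : (\sum_(m <= i < (m + k).+1) i) * 2 = k.+1 * (2 * m + k).
  elim: k => [|k IHk]; first by rewrite addn0 big_nat1; lia.
  by rewrite addnS big_nat_recr /= ?mulnDl ?IHk; lia.
have -> : m.+1 + r.+1 = m + r.+2 by lia.
have -> : 2 * m.+1 + r.+1 - 1 = 2 * m + r.+2 by lia.
rewrite addn2 -step [2 * _]mulnC; congr (_ == _).
by have := sum1n m; have := sum1n m.+1; lia.
Qed.

(* (m, r) |-> (29 m + 12 r - 6, 12 m + 5 r - 4) maps solutions to larger ones. *)
Lemma neobc_unbounded k : exists m, (k < m) && `[< is_neobc m >].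
Proof.
suff [m [r [km mr]]] : exists m r, k < m /\ is_neobalcobalancer m r.
  by exists m; rewrite km; apply/asboolP; exists r.
elim: k => [|k [m [r [km]]]].
  by exists 6, 1; rewrite is_neobalcobalancerE.
rewrite is_neobalcobalancerE => /and3P[m0 r0 /eqP mrE].
exists (29 * m + 12 * r - 6), (12 * m + 5 * r - 4); split; first by lia.
rewrite is_neobalcobalancerE; apply/and3P; split; [lia|lia|apply/eqP].
case: m m0 r0 mrE {km} => // m _; case: r => // r _.
have -> : 2 * m.+1 + r.+1 - 1 = 2 * m + r + 2 by lia.
have -> : 29 * m.+1 + 12 * r.+1 - 6 = 29 * m + 12 * r + 35 by lia.
have -> : 12 * m.+1 + 5 * r.+1 - 4 = 12 * m + 5 * r + 13 by lia.
have -> : 2 * (29 * m + 12 * r + 35) + (12 * m + 5 * r + 13) - 1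
          = 70 * m + 29 * r + 82 by lia.
by lia.
Qed.

(* As neo balcobalancing numbers are positive, starting from the conventional
   value 0 makes [neobcB n] the n-th one for every n >= 1. *)
Fixpoint neobcB (n : nat) : nat :=
  if n is n'.+1 then ex_minn (neobc_unbounded (neobcB n')) else 0.

Lemma neobcBP n : is_neobc (neobcB n.+1).
Proof. by rewrite /=; case: ex_minnP => m /andP[_ /asboolP]. Qed.

Lemma neobcB_lt n : neobcB n < neobcB n.+1.
Proof. by rewrite /=; case: ex_minnP => m /andP[]. Qed.

Lemma neobcB_onto m : is_neobc m -> exists n, m = neobcB n.+1.
Proof.
move=> mP; have m0 : 0 < m by have [r /and3P[]] := mP.
have nB n : n <= neobcB n.
  by elim: n => // n IHn; apply: leq_ltn_trans IHn (neobcB_lt n).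
have ex : exists n, m <= neobcB n by exists m.
case: (ex_minnP ex) => -[|n]; first by rewrite leqNgt m0.
move=> le_m min; exists n; apply/eqP; rewrite eqn_leq le_m /=.
have lt_m : neobcB n < m.
  by rewrite ltnNge; apply/negP => /min; rewrite ltnn.
case: ex_minnP => q _; apply; rewrite lt_m.
exact/asboolP.
Qed.

Definition neobcR (n : nat) : nat :=
  if n is n'.+1 then xchoose (neobcBP n') else 1.

Local Open Scope ring_scope.

Definition neobcC (R : realType) (n : nat) : R :=
  if n is 0 then 3
  else Num.sqrt (8 * (neobcB n)%:R ^+ 2 - 12 * (neobcB n)%:R + 9).

Definition neobcCR (R : realType) (n : nat) : R :=
  if n is 0 then 3
  else Num.sqrt (2 * (neobcR n)%:R ^+ 2 + 5 * (neobcR n)%:R + 2).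

(* Main.v *)
Require Import Defs.
From mathcomp Require Import all_boot all_order all_algebra.
From mathcomp Require Import boolp reals.
From mathcomp Require Import zify ring.

(* Writing r = q + 1, the defining equation becomes m^2 = (q + 3)(2m + q), and
   with x = (4m - 3) / 3 and c = (2m + 2q + 3) / 3 it is the Pell equation
   x^2 - 2c^2 = -1. Multiplication by the unit (1 + sqrt 2)^4 = 17 + 12 sqrt 2
   acts on the pairs (m, q) as (m, q) |-> (29m + 12q + 6, 12m + 5q). Descent by
   the inverse map shows that every solution lies in the orbit of (0, 0), which
   is the pair given by the conventions for n = 0. As B increases along the
   orbit, (B_n, R_n - 1) is its n-th point. Moreover C_n = 2m + 2q + 3 and, for
   n >= 1, CR_n = m - q - 3, so all four identities become polynomial
   consequences of the equation at the (n-1)-st point. *)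

Import Order.TTheory GRing.Theory Num.Theory.

(** The shift r = q + 1 avoids truncated subtraction; m = 0 is allowed so that the orbit can start
    at (0, 0). *)
Definition neobc_sol (m q : nat) : bool := (m * m == (q + 3) * (2 * m + q))%N.

Definition neobc_step (p : nat * nat) : nat * nat :=
  (29 * p.1 + 12 * p.2 + 6, 12 * p.1 + 5 * p.2)%N.

Definition neobc_orbit (n : nat) : nat * nat := iter n neobc_step (0%N, 0%N).

Lemma neobalcobalancer_sol m q :
  is_neobalcobalancer m q.+1 = (0 < m)%N && neobc_sol m q.
Proof.
rewrite is_neobalcobalancerE /neobc_sol /= addSnnS.
by have -> : (2 * m + q.+1 - 1 = 2 * m + q)%N by lia.
Qed.

(** For fixed m the right-hand side strictly increases in q. This pins down the witness picked by
    [xchoose] in [neobcR]. *)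
Lemma neobc_sol_inj m q q' : neobc_sol m q -> neobc_sol m q' -> q = q'.
Proof.
move=> /eqP h /eqP h'; apply/eqP; rewrite eqn_leq.
by apply/andP; split; rewrite leqNgt; apply/negP; nia.
Qed.

Lemma neobc_step_sol p :
  neobc_sol p.1 p.2 -> neobc_sol (neobc_step p).1 (neobc_step p).2.
Proof. by case: p => m q; rewrite /neobc_sol /= => /eqP h; apply/eqP; nia. Qed.

Lemma neobc_orbit_sol n : neobc_sol (neobc_orbit n).1 (neobc_orbit n).2.
Proof. by elim: n => // n; apply: neobc_step_sol. Qed.

Lemma neobc_descent m q : (0 < m)%N -> neobc_sol m q ->
  exists2 p, neobc_sol p.1 p.2 & (m, q) = neobc_step p.
Proof.
move=> m0 /eqP h.
(* [a0] and [b0] say that the preimage has nonnegative coordinates, so its truncated subtractions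
   are exact. *)
have a0 : (12 * q + 30 <= 5 * m)%N by nia.
(* positivity of 2m' + 2q' + 3 at the preimage (m', q') *)
have c0 : (14 * m < 34 * q + 87)%N by nia.
have b0 : (12 * m <= 29 * q + 72)%N.
  (* Otherwise (k, -l) is the preimage, with k^2 = (3 - l)(2k - l), and 1 <= l <= k + 1 by [b1] and
     [c0]. This bounds k, leaving finitely many cases. *)
  rewrite leqNgt; apply/negP => b1.
  have [k ek] : exists k, (5 * m = 12 * q + 30 + k)%N.
    by exists (5 * m - (12 * q + 30))%N; lia.
  have [l el] : exists l, (12 * m = 29 * q + 72 + l)%N.
    by exists (12 * m - (29 * q + 72))%N; lia.
  have [em eq] : m = (29 * k - 12 * l + 6)%N /\ q = (12 * k - 5 * l)%N by lia.
  have k6 : (k < 6)%N by nia.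
  by do 6?[case: k ek em eq k6 => [|k] ek em eq k6]; nia.
exists (5 * m - (12 * q + 30), 29 * q + 72 - 12 * m)%N; last first.
  by rewrite /neobc_step /=; congr pair; lia.
rewrite /neobc_sol /=; apply/eqP.
move: (subnKC a0) (subnKC b0).
set a := (5 * m - _)%N; set b := (_ - 12 * m)%N => ea eb.
have [em eq] : m = (29 * a + 12 * b + 6)%N /\ q = (12 * a + 5 * b)%N by lia.
by move: h; rewrite em eq; lia.
Qed.

Lemma neobc_sol_orbit m q : neobc_sol m q -> exists n, (m, q) = neobc_orbit n.
Proof.
elim/ltn_ind: m q => m IH q h.
have [m0|m0] := posnP m.
  by exists 0%N; move: h; rewrite m0 /neobc_sol => /eqP h; congr pair; nia.
have [[a b] /= hab e] := neobc_descent _ _ m0 h.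
(* The descent terminates: m = 29a + 12b + 6 exceeds a. *)
have [|n en] := IH a _ b hab; first by case: e => -> _; lia.
by exists n.+1; rewrite e en.
Qed.

Lemma neobc_orbit_lt n : ((neobc_orbit n).1 < (neobc_orbit n.+1).1)%N.
Proof. by rewrite /= /neobc_step /=; lia. Qed.

Lemma neobc_orbit_mono : {mono (fun n => (neobc_orbit n).1) : i j / (i <= j)%N}.
Proof.
apply: leq_mono; apply: homo_ltn; first exact: ltn_trans.
exact: neobc_orbit_lt.
Qed.

Lemma neobcB_orbit n : neobcB n = (neobc_orbit n).1.
Proof.
elim: n => // n IHn; rewrite [LHS]/= IHn.
case: ex_minnP => m /andP[lt_m /asboolP[[|q]]].
  by rewrite is_neobalcobalancerE andbF.
rewrite neobalcobalancer_sol => /andP[m0 /neobc_sol_orbit[k ek]] min.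
apply/eqP; rewrite eqn_leq min; last first.
  apply/andP; split; first exact: neobc_orbit_lt.
  apply/asboolP; exists (neobc_orbit n.+1).2.+1.
  rewrite neobalcobalancer_sol neobc_orbit_sol andbT.
  exact: leq_ltn_trans (neobc_orbit_lt n).
(* Conversely, m is the k-th orbit point and lies above the n-th, so n < k by monotonicity. *)
move: lt_m; rewrite -[m]/(m, q).1 ek /=.
by rewrite (leqW_mono neobc_orbit_mono) -(neobc_orbit_mono n.+1 k).
Qed.

Lemma neobcR_orbit n : neobcR n = (neobc_orbit n).2.+1.
Proof.
case: n => [//|n]; rewrite /neobcR; have := xchooseP (neobcBP n).
case: (xchoose _) => [|q]; first by rewrite is_neobalcobalancerE andbF.
rewrite neobalcobalancer_sol neobcB_orbit => /andP[_ h].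
by rewrite (neobc_sol_inj _ _ _ h (neobc_orbit_sol n.+1)).
Qed.

Local Open Scope ring_scope.

Lemma neobcR_orbitr (R : realType) n :
  (neobcR n)%:R = (neobc_orbit n).2%:R + 1 :> R.
Proof. by rewrite neobcR_orbit natr1. Qed.

Lemma neobc_orbit_eqr (R : realType) n (p := neobc_orbit n) :
  p.1%:R ^+ 2 = (p.2%:R + 3) * (2 * p.1%:R + p.2%:R) :> R.
Proof.
have /eqP h : neobc_sol p.1 p.2 := neobc_orbit_sol n.
by have hR := congr1 (fun k => k%:R : R) h; rewrite expr2 -natrM hR; ring.
Qed.

Lemma neobcC_orbit (R : realType) n (p := neobc_orbit n) :
  neobcC R n = 2 * p.1%:R + 2 * p.2%:R + 3.
Proof.
have := neobc_orbit_eqr R n; rewrite -/p => h.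
case: n @p h => [|n] p h; first by rewrite /neobcC /=; ring.
rewrite /neobcC neobcB_orbit -/p.
have -> : 8 * p.1%:R ^+ 2 - 12 * p.1%:R + 9
          = (2 * p.1%:R + 2 * p.2%:R + 3) ^+ 2 :> R by ring: h.
by rewrite sqrtr_sqr ger0_norm // !addr_ge0 ?mulr_ge0 ?ler0n.
Qed.

(** Index 0 is excluded: there m - q - 3 = -3, whereas the convention is 3. Hence the bound n >= 2
    in the last identity. *)
Lemma neobcCR_orbit (R : realType) n (p := neobc_orbit n.+1) :
  neobcCR R n.+1 = p.1%:R - p.2%:R - 3.
Proof.
have := neobc_orbit_eqr R n.+1; rewrite -/p => h.
rewrite /neobcCR neobcR_orbitr -/p.
have -> : 2 * (p.2%:R + 1) ^+ 2 + 5 * (p.2%:R + 1) + 2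
          = (p.1%:R - p.2%:R - 3) ^+ 2 :> R by ring: h.
rewrite sqrtr_sqr ger0_norm // -addrA -opprD subr_ge0 -natrD ler_nat.
by rewrite /p /= /neobc_step /=; lia.
Qed.

Lemma neobc_orbitSr (R : realType) n (p := neobc_orbit n) :
  ((neobc_orbit n.+1).1%:R = 29 * p.1%:R + 12 * p.2%:R + 6 :> R) *
  ((neobc_orbit n.+1).2%:R = 12 * p.1%:R + 5 * p.2%:R :> R).
Proof. by split; rewrite /neobc_step /= -/p; ring. Qed.

Theorem theorem8p1 (R : realType) :
  (forall n : nat, (1 <= n)%N ->
    [/\ (neobcB n.-1)%:R * (neobcB n.+1)%:R - (neobcB n)%:R ^+ 2
          = (3 * (neobcB n.+1)%:R - 6 * (neobcB n)%:R
             + 3 * (neobcB n.-1)%:R - 648) / 4 :> R,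
        neobcC R n.-1 * neobcC R n.+1 - neobcC R n ^+ 2 = 1296
      & (neobcR n.-1)%:R * (neobcR n.+1)%:R - (neobcR n)%:R ^+ 2
          = (- 5 * (neobcR n.+1)%:R + 10 * (neobcR n)%:R
             - 5 * (neobcR n.-1)%:R + 648) / 4 :> R]) /\
  (forall n : nat, (2 <= n)%N ->
    neobcCR R n.-1 * neobcCR R n.+1 - neobcCR R n ^+ 2 = - 324).
Proof.
split=> [[//|n] _|[|[|n]] // _].
  have h := neobc_orbit_eqr R n.
  rewrite !neobcB_orbit !neobcC_orbit !neobcR_orbitr !neobc_orbitSr.
  by split; field: h.
have h := neobc_orbit_eqr R n.+1.
(* Explicit indices stop the unfolding at the point n + 1, where [h] applies. *)
rewrite !neobcCR_orbit !(neobc_orbitSr R n.+2) !(neobc_orbitSr R n.+1).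
by ring: h.
Qed.
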